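(* Let $L$ be a finite modular non-distributive lattice and let $K$ be a field. Then, for any monomial order $<$ on $K[L]$, the initial ideal $\operatorname{in}_<(I_L)$ is not squarefree (that is, it is not generated by squarefree monomials).
   Context: For a finite lattice $L$ and a field $K$, $K[L]$ denotes the polynomial ring over $K$ whose variables are the elements of $L$. The join-meet ideal of $L$ is $$I_L=\big(ab-(a\wedge b)(a\vee b)\;:\; a,b\in L,\ a,b \text{ incomparable}\big)\subset K[L].$$ For a monomial order $<$, $\operatorname{in}_<(I)$ is the ideal generated by the initial (leading) monomials of all nonzero elements of $I$. *)

(* Defs.v *)
From HB Require Import structures.
From mathcomp Require Import all_boot all_order all_algebra.
From mathcomp Require Import finmap.
From mathcomp.multinomials Require Import monalg.

Set Implicit Arguments.
Unset Strict Implicit.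
Unset Printing Implicit Defensive.

Import Order.TTheory GRing.Theory.

Local Open Scope ring_scope.

Definition modular_lattice (d : Order.disp_t) (L : latticeType d) : Prop :=
  forall x y z : L, (x <= z -> x `|` (y `&` z) = (x `|` y) `&` z)%O.

Definition distributive_lattice (d : Order.disp_t) (L : latticeType d) : Prop :=
  forall x y z : L, (x `&` (y `|` z) = (x `&` y) `|` (x `&` z))%O.

Definition ideal_gen (R : comNzRingType) (S : R -> Prop) (p : R) : Prop :=
  exists2 s : seq (R * R),
    (forall u, u \in s -> S u.2) & p = \sum_(u <- s) u.1 * u.2.

(* The polynomial ring over K with variables the elements of L is
   {malg K[{cmonom L}]}.  Its monomials are the elements of the free commutative
   monoid {cmonom L}, written multiplicatively in %M; m i is the exponent of the
   variable i in m. *)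
Definition var (K : fieldType) (L : choiceType) (a : L) : {malg K[{cmonom L}]} :=
  << ucm a >>.

Section JoinMeetIdeal.
Context (K : fieldType) (d : Order.disp_t) (L : finLatticeType d).

Definition join_meet_gen (p : {malg K[{cmonom L}]}) : Prop :=
  exists a b : L, (a >< b)%O /\
    p = var K a * var K b - var K (a `&` b)%O * var K (a `|` b)%O.

Definition join_meet_ideal : {malg K[{cmonom L}]} -> Prop := ideal_gen join_meet_gen.

End JoinMeetIdeal.

(* le is the non-strict relation of the order; reflexivity is part of total. *)
Definition monomial_order (L : choiceType) (le : rel {cmonom L}) : Prop :=
  [/\ total le, antisymmetric le, transitive le,
      forall m : {cmonom L}, le mone m
    & forall m1 m2 m : {cmonom L}, le m1 m2 -> le (mmul m1 m) (mmul m2 m)].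

Section InitialIdeal.
Context (K : fieldType) (L : choiceType).
Implicit Types (le : rel {cmonom L}) (I J : {malg K[{cmonom L}]} -> Prop).

(* No m satisfies this when f = 0, whose support is empty. *)
Definition is_initial_monomial le (f : {malg K[{cmonom L}]}) (m : {cmonom L}) : Prop :=
  m \in msupp f /\ (forall m', m' \in msupp f -> le m' m).

Definition monomial_ideal (S : {cmonom L} -> Prop) : {malg K[{cmonom L}]} -> Prop :=
  ideal_gen (fun p => exists2 m, S m & p = << m >>).

Definition initial_ideal le I : {malg K[{cmonom L}]} -> Prop :=
  monomial_ideal (fun m =>
    exists f, [/\ I f, f != 0 & is_initial_monomial le f m]).

Definition squarefree_monomial (m : {cmonom L}) : Prop :=
  forall i : L, (m i <= 1)%N.

Definition squarefree_ideal J : Prop :=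
  exists2 S : {cmonom L} -> Prop,
    (forall m, S m -> squarefree_monomial m)
    & (forall p, J p <-> monomial_ideal S p).

End InitialIdeal.

(* Main.v *)
Require Import Defs.
From HB Require Import structures.
From mathcomp Require Import all_boot all_order all_algebra.
From mathcomp Require Import finmap.
From mathcomp.multinomials Require Import monalg.
From mathcomp Require Import zify.

Set Implicit Arguments.
Unset Strict Implicit.
Unset Printing Implicit Defensive.

Import Order.TTheory GRing.Theory.

Local Open Scope ring_scope.

(** The join-meet ideal I is generated by binomials u - v, so modulo I the
monomials fall into congruence classes, and a function T on monomials that is
constant on each class gives a linear form, the sum of the coefficients over
the monomials of T, that vanishes on I ([coeff_sum_ideal]).  Hence the smallest
monomial of such a set T is standard: neither it nor any of its divisors is an
initial monomial of I ([standard_not_initial]).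

Suppose in(I) is squarefree.  Every initial monomial m then has a squarefree
initial divisor, which divides any monomial whose support contains that of m.
So no initial monomial is supported on the variables of a standard monomial m0,
and two congruent monomials supported on those variables must be equal
([standard_independent]): otherwise the larger one would be the initial
monomial of their difference, whichever of the two it is.

The lattice provides an interval [o, i] of length two with at least three
elements strictly between the ends ([modular_nondistributive_line]).  If a
distributive law fails at x, y, z, the lower and the upper median of x, y, z
are the ends of a diamond (a sublattice M_3); an element strictly between the
bottom and one of the three atoms of a diamond produces, by perspectivity, a
smaller diamond, and a diamond that cannot be shrunk has length two.

In [o, i] the products xy of distinct middle elements are all congruent to oi,
hence, thanks to the third middle element, x^2 y ~ x oi ~ y oi ~ x y^2, and
x^2 oi ~ (xy)(xz) ~ (oi)^2.  The class of oi consists of oi and the products xy,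
and its smallest element m0 is standard.
 - If m0 = xy, then x^2 y ~ x y^2 contradicts independence over m0.
 - If m0 = oi, let x be the smallest middle variable.  The class of x oi
   consists of monomials z p with z a middle element and p in the class of oi,
   so x oi is its smallest element, and x^2 oi ~ (oi)^2 contradicts
   independence over x oi. *)

(** * Lines in modular lattices *)

(** Joins on the left and meets on the right of an inequality are split first,
because that loses nothing; only the other four rules need backtracking. *)
Ltac lattice_le :=
  first [ exact: lexx | assumption
        | rewrite leUx; apply/andP; split; lattice_le
        | rewrite lexI; apply/andP; split; lattice_le
        | apply: leIxl; lattice_le | apply: leIxr; lattice_le
        | apply: lexUl; lattice_le | apply: lexUr; lattice_le ].

Section Median.
Context (d : Order.disp_t) (L : latticeType d).
Implicit Types x y z : L.
Local Open Scope order_scope.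

Definition lower_median x y z := (x `&` y) `|` (y `&` z) `|` (z `&` x).
Definition upper_median x y z := (x `|` y) `&` (y `|` z) `&` (z `|` x).

Lemma lower_median_rot x y z : lower_median y z x = lower_median x y z.
Proof. by rewrite /lower_median joinC joinA. Qed.

Lemma upper_median_rot x y z : upper_median y z x = upper_median x y z.
Proof. by rewrite /upper_median meetC meetA. Qed.

Lemma le_median x y z : lower_median x y z <= upper_median x y z.
Proof.
rewrite /lower_median /upper_median; lattice_le.
Qed.

Hypothesis Lmod : modular_lattice L.

(** Both sides of the intersection lie above m, so the modular law reduces the
claim to (x /\ M) /\ (m \/ (y /\ M)) <= m; the second factor is below
y \/ (z /\ x), and one more use of the law gives (z /\ x) \/ (y /\ x). *)
Lemma median_meet x y z (m := lower_median x y z) (M := upper_median x y z) :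
  (m `|` (x `&` M)) `&` (m `|` (y `&` M)) = m.
Proof.
apply/le_anti/andP; split; last by rewrite lexI !leUl.
rewrite -Lmod ?leUl// leUx lexx/=.
have mM : m <= M := le_median x y z.
have yM : m `|` (y `&` M) <= y `|` (z `&` x).
  rewrite /m /lower_median; lattice_le.
apply: (@le_trans _ _ (((z `&` x) `|` y) `&` x)).
  rewrite lexI; apply/andP; split; last lattice_le.
  by apply: leIxr; rewrite (joinC _ y).
by rewrite -Lmod ?leIr// /m /lower_median; rewrite (meetC y x); lattice_le.
Qed.
End Median.

Lemma modular_dual (d : Order.disp_t) (L : latticeType d) :
  modular_lattice L -> modular_lattice (L^d)%O.
Proof.
move=> Lmod x y z zx; have := Lmod z y x zx.
by rewrite joinC meetC [X in _ = X]meetC [X in _ = (_ `&` X)%O]joinC.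
Qed.

Lemma median_join (d : Order.disp_t) (L : latticeType d)
    (Lmod : modular_lattice L) (x y z : L)
    (m := lower_median x y z) (M := upper_median x y z) :
  ((M `&` (x `|` m)) `|` (M `&` (y `|` m)) = M)%O.
Proof. exact: (median_meet (modular_dual Lmod) x y z). Qed.

Section Diamond.
Context (d : Order.disp_t) (L : finLatticeType d) (Lmod : modular_lattice L).
Implicit Types o a b c i p x y z : L.
Local Open Scope order_scope.

(** The sublattice M_3 with bottom o, top i and atoms a, b, c. *)
Definition diamond o a b c i : Prop :=
  [/\ [/\ a `&` b = o, b `&` c = o & c `&` a = o],
      [/\ a `|` b = i, b `|` c = i & c `|` a = i] & o < i].

Lemma diamond_rot o a b c i : diamond o a b c i -> diamond o b c a i.
Proof. by case=> -[? ? ?] [? ? ?]; split. Qed.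

(** The atoms are x, y, z moved into the interval [m, M] by t |-> m \/ (t /\ M),
which the modular law makes self-dual; so the joins are dual to the meets.  The
bottom and the top differ because m = M would give
x /\ (y \/ z) = x /\ M = x /\ m, and x /\ m simplifies by the modular law to
(x /\ y) \/ (x /\ z). *)
Lemma median_diamond x y z (m := lower_median x y z) (M := upper_median x y z) :
  x `&` (y `|` z) <> (x `&` y) `|` (x `&` z) ->
  diamond m (m `|` (x `&` M)) (m `|` (y `&` M)) (m `|` (z `&` M)) M.
Proof.
move=> xyz.
have mM : m <= M := le_median x y z.
have E t : m `|` (t `&` M) = M `&` (t `|` m) by rewrite Lmod // meetC (joinC m).
split.
- split; first exact: median_meet.
  + by have := median_meet Lmod y z x; rewrite lower_median_rot upper_median_rot.
  + by have := median_meet Lmod z x y; rewrite -lower_median_rot -upper_median_rot.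
- rewrite !E; split; first exact: median_join.
  + by have := median_join Lmod y z x; rewrite lower_median_rot upper_median_rot.
  + by have := median_join Lmod z x y; rewrite -lower_median_rot -upper_median_rot.
rewrite lt_neqAle mM andbT; apply/eqP => mMeq; apply: xyz.
have <- : x `&` M = x `&` (y `|` z).
  apply/le_anti/andP; split; rewrite /M /upper_median; lattice_le.
have -> : x `&` M = ((x `&` y) `|` (x `&` z)) `|` ((y `&` z) `&` x).
  rewrite -mMeq /m /lower_median (meetC z x) joinAC meetC.
  by rewrite [RHS]Lmod //; lattice_le.
apply/join_idPl; lattice_le.
Qed.

(** The two new atoms are the images of p under the perspectivities
[o, a] -> [c, i] -> [o, b] and [o, a] -> [b, i] -> [o, c]. The top becomes
smaller because p \/ b = i would force p = p \/ (b /\ a) = (p \/ b) /\ a = a. *)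
Lemma diamond_shrink o a b c i p : diamond o a b c i -> o < p -> p < a ->
  exists2 t, diamond o p ((p `|` c) `&` b) ((p `|` b) `&` c) t & t < i.
Proof.
move=> [[ab bc ca] [Uab Ubc Uca] oi] op pa.
have [ole pale] := (ltW op, ltW pa).
have [oa ob oc] : [/\ o <= a, o <= b & o <= c].
  by split; [rewrite -ab | rewrite -ab | rewrite -ca]; lattice_le.
pose t := (p `|` b) `&` (p `|` c).
have pb_i : p `|` b < i.
  rewrite lt_neqAle; apply/andP; split; last by rewrite -Uab leU2.
  apply: contraTN pa => /eqP pbi; suff -> : a = p by rewrite ltxx.
  have <- : p `|` (b `&` a) = p by rewrite meetC ab; apply/join_idPl.
  by rewrite Lmod // pbi -Uab meetC joinKI.
(* all three joins are equal to t *)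
exists t; last exact: le_lt_trans (leIl _ _) pb_i.
have [opb opc] : o <= p `|` b /\ o <= p `|` c by split; lattice_le.
have q_pb : p `|` (p `|` c) `&` b = t by rewrite meetC Lmod // lexUl.
have r_pc : p `|` (p `|` b) `&` c = t.
  by rewrite meetC Lmod ?lexUl // /t meetC.
split; [split|split|].
- by apply/le_anti; rewrite !lexI ole opc ob !andbT -ab; lattice_le.
- by apply/le_anti; rewrite !lexI oc opb opc ob !andbT -bc; lattice_le.
- by apply/le_anti; rewrite !lexI ole opb oc !andbT -ca; lattice_le.
- exact: q_pb.
- rewrite (meetC (p `|` b)) Lmod; last lattice_le.
  have -> : ((p `|` c) `&` b) `|` c = p `|` c.
    rewrite joinC meetC Lmod; last lattice_le.
    rewrite (joinC c) Ubc; apply/meet_idPr.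
    by rewrite -Uca joinC leU2.
  by rewrite meetC.
- by rewrite joinC.
- by apply: (lt_le_trans op); lattice_le.
Qed.

(** What length two means for moves inside [o, i]: the elements strictly between
the ends meet and join like the points of a projective line. *)
Definition line o i : Prop :=
  forall x y, o < x < i -> o < y < i -> x != y -> x `&` y = o /\ x `|` y = i.

(** If a and b are atoms over o, then i covers a because b is an atom, and every
other middle element is a complement of a.  Modularity forbids two comparable
complements of a, so middle elements are pairwise incomparable. *)
Lemma atoms_diamond o a b c i : diamond o a b c i ->
    (forall p, o < p -> ~~ (p < a)) -> (forall p, o < p -> ~~ (p < b)) ->
  line o i.
Proof.
move=> [[ab bc ca] [Uab Ubc Uca] oi] atom_a atom_b.
have atomE e (atom_e : forall p, o < p -> ~~ (p < e)) (oe : o <= e) x :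
    o <= x -> x <= e -> x = o \/ x = e.
  rewrite le_eqVlt => /predU1P[->|/atom_e xe]; first by left.
  by rewrite le_eqVlt (negPf xe) orbF => /eqP; right.
have [oa ob] : o <= a /\ o <= b by rewrite -ab; split; lattice_le.
(* i covers a because b is an atom: x /\ b is o or b *)
have coatom_a x : a <= x -> x < i -> x = a.
  move=> ax xi.
  have [||xb|xb] := @atomE b atom_b ob (x `&` b).
  - by rewrite lexI ob (le_trans oa).
  - exact: leIr.
  - have : a `|` (b `&` x) = x by rewrite Lmod // Uab; apply/meet_idPr/ltW.
    by rewrite meetC xb => <-; apply/join_idPl.
  - have : i <= x by rewrite -Uab leUx ax -xb leIl.
    by rewrite lt_geF.
have compl x : o < x < i -> x != a -> x `&` a = o /\ x `|` a = i.
  move=> /andP[ox xi] /eqP xa; split.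
    have [||//|xaE] := @atomE a atom_a oa (x `&` a); first by rewrite lexI oa ltW.
      exact: leIr.
    by case: xa; apply: coatom_a => //; rewrite -xaE leIl.
  apply/eqP/negPn/negP => xai; case: xa.
  have {xai} xaE : x `|` a = a.
    apply: coatom_a; first exact: leUr.
    by rewrite lt_neqAle xai leUx ltW // -Uab leUl.
  have [||xo|//] := @atomE a atom_a oa x; [exact: ltW | by rewrite -xaE leUl |].
  by rewrite xo ltxx in ox.
have mid_eq x y : o < y -> y <= x -> x < i -> y = x.
  move=> oy yx xi; have ox := lt_le_trans oy yx; have yi := le_lt_trans yx xi.
  have [xa|xa] := eqVneq x a.
    have [||yo|->//] := @atomE a atom_a oa y; [exact: ltW | by rewrite -xa |].
    by rewrite yo ltxx in oy.
  have ya : y != a.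
    by apply: contraNneq xa => ya; apply/eqP/coatom_a; rewrite // -ya.
  have [xao _] : x `&` a = o /\ x `|` a = i by apply: compl; rewrite ?ox.
  have [_ yai] : y `&` a = o /\ y `|` a = i by apply: compl; rewrite ?oy.
  have : y `|` (a `&` x) = x by rewrite Lmod // yai; apply/meet_idPr/ltW.
  by rewrite meetC xao => <-; apply/esym/join_idPl/ltW.
move=> x y /andP[ox xi] /andP[oy yi] /eqP xy; split.
  apply/eqP/negPn/negP => xyo; case: xy.
  have oxy : o < x `&` y by rewrite lt_neqAle eq_sym xyo lexI !ltW.
  exact: etrans (esym (mid_eq x _ oxy (leIl _ _) xi))
                (mid_eq y _ oxy (leIr _ _) yi).
apply/eqP/negPn/negP => xyi; case: xy.
have xyi' : x `|` y < i by rewrite lt_neqAle xyi leUx !ltW.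
exact: etrans (mid_eq _ _ ox (leUl _ _) xyi')
              (esym (mid_eq _ _ oy (leUr _ _) xyi')).
Qed.

(** Shrinking lowers the top of the diamond, so it stops; two atoms of the
diamond are then atoms of the lattice over the bottom, which is enough for
[atoms_diamond]. *)
Lemma diamond_line o a b c i : diamond o a b c i ->
  exists o' i', line o' i' /\ exists a' b' c', diamond o' a' b' c' i'.
Proof.
have [n] := ubnP #|[pred x | x <= i]|; elim: n => // n IHn in o a b c i *.
rewrite ltnS => cardi D.
(* whatever the atom e, the induction applies to the diamond built from p *)
have shrink e f g p : diamond o e f g i -> o < p -> p < e ->
    exists o' i', line o' i' /\ exists a' b' c', diamond o' a' b' c' i'.
  move=> D' op pe; have [t Dt ti] := diamond_shrink D' op pe.
  apply: (IHn _ _ _ _ _ _ Dt); apply: leq_trans cardi; apply: proper_card.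
  apply/properP; split; first by apply/subsetP => x /le_trans; apply; apply: ltW.
  by exists i; rewrite !inE ?lexx // lt_geF.
have [/existsP[p /andP[op pa]]|Na] := boolP [exists p, (o < p) && (p < a)].
  exact: shrink D op pa.
have [/existsP[p /andP[op pb]]|Nb] := boolP [exists p, (o < p) && (p < b)].
  exact: shrink (diamond_rot D) op pb.
exists o, i; split; last by exists a, b, c.
apply: (atoms_diamond D) => p op; apply: contraT => /negPn pe.
  by case/existsP: Na; exists p; rewrite op.
by case/existsP: Nb; exists p; rewrite op.
Qed.

Lemma diamond_mid o a b c i : diamond o a b c i -> o < a < i.
Proof.
move=> [[ab bc ca] [Uab Ubc Uca] oi]; apply/andP; split.
  rewrite lt_neqAle -{2}ab leIl andbT; apply: contraTneq oi => oa.
  suff: b = c by move=> bc'; rewrite -Ubc -bc bc' joinxx meetxx ltxx.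
  have -> : b = i by rewrite -Uab; apply/esym/join_idPr; rewrite -oa -ab leIr.
  by rewrite -Uca; apply/join_idPl; rewrite -oa -ca leIl.
rewrite lt_neqAle -{2}Uab leUl andbT; apply: contraTneq oi => ai.
suff: b = c by move=> bc'; rewrite -Ubc -bc bc' joinxx meetxx ltxx.
have -> : b = o by rewrite -ab; apply/esym/meet_idPr; rewrite ai -Uab leUr.
by rewrite -ca; apply/meet_idPl; rewrite ai -Uca leUl.
Qed.

Lemma diamond_neq o a b c i : diamond o a b c i -> a != b.
Proof.
case=> -[ab _ _] [Uab _ _]; apply: contraTneq => ab'.
by rewrite -ab -Uab ab' meetxx joinxx ltxx.
Qed.

Lemma modular_nondistributive_line : ~ distributive_lattice L ->
  exists o i, line o i /\ exists a b c,
    [/\ o < a < i, o < b < i, o < c < i & [/\ a != b, b != c & c != a]].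
Proof.
move=> ndistr.
have [/forallP distr|] := boolP [forall x : L, [forall y : L, [forall z : L,
    x `&` (y `|` z) == (x `&` y) `|` (x `&` z)]]].
  by case: ndistr => x y z; apply/eqP; move: (distr x) => /forallP/(_ y)/forallP.
move=> /forallPn[x /forallPn[y /forallPn[z /eqP xyz]]].
have [o [i [oi_line [a [b [c D]]]]]] := diamond_line (median_diamond xyz).
have D' := diamond_rot D; have D'' := diamond_rot D'.
exists o, i; split=> //; exists a, b, c.
split; [exact: diamond_mid D | exact: diamond_mid D' | exact: diamond_mid D'' |].
by split; [exact: diamond_neq D | exact: diamond_neq D' | exact: diamond_neq D''].
Qed.
End Diamond.

(** * Ideals generated by monomials and binomials *)

Lemma mmulCA (M : conomType) : left_commutative (@mmul M).
Proof. by move=> x y z; rewrite !mulmA (mulmC x). Qed.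

Lemma mmulACA (M : conomType) : interchange (@mmul M) (@mmul M).
Proof. by move=> x y z t; rewrite -!mulmA (mmulCA y). Qed.

Section Ideals.
Context (R : comNzRingType) (S : R -> Prop).

Lemma ideal_gen_mem p : S p -> ideal_gen S p.
Proof.
move=> Sp; exists [:: (1, p)]; last by rewrite big_seq1 mul1r.
by move=> u; rewrite inE => /eqP->.
Qed.

Lemma ideal_genD p q : ideal_gen S p -> ideal_gen S q -> ideal_gen S (p + q).
Proof.
move=> [s Ss ->] [t St ->]; exists (s ++ t); last by rewrite big_cat.
by move=> u; rewrite mem_cat => /orP[/Ss|/St].
Qed.

Lemma ideal_genM r p : ideal_gen S p -> ideal_gen S (r * p).
Proof.
move=> [s Ss ->]; exists [seq (r * u.1, u.2) | u <- s].
  by move=> _ /mapP[u us ->]; exact: (Ss _ us).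
by rewrite big_map mulr_sumr; apply: eq_bigr => u _; rewrite mulrA.
Qed.

Lemma ideal_gen0 : ideal_gen S 0.
Proof. by exists [::]; rewrite ?big_nil. Qed.
End Ideals.

Lemma malgUM (M : monomType) (R : nzRingType) (c : R) (m n : M) :
  << c *g m >> * << n >> = << c *g mmul m n >> :> {malg R[M]}.
Proof. by rewrite malgM_def fgmulUU mulr1. Qed.

Lemma mmap_binomialM (M : monomType) (R : nzRingType) (h : M -> R)
    (p : {malg R[M]}) (m m' : M) :
  (forall n, h (mmul n m) = h (mmul n m')) ->
  mmap idfun h (p * (<< m >> - << m' >>)) = 0.
Proof.
move=> hmm'; rewrite [p]monalgE mulr_suml raddf_sum big1 // => n _.
by rewrite mulrBr !malgUM raddfB /= !mmapU /= hmm' subrr.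
Qed.

Lemma binomialM (M : conomType) (R : comNzRingType) (m1 m1' m2 m2' : M) :
  << mmul m1 m2 >> - << mmul m1' m2' >> =
    << m1 >> * (<< m2 >> - << m2' >>) + << m2' >> * (<< m1 >> - << m1' >>)
    :> {malg R[M]}.
Proof. by rewrite !mulrBr !malgUM !(mulmC m2') addrA subrK. Qed.

Lemma msupp_binomial (M : choiceType) (R : nzRingType) (m m' : M) : m != m' ->
  forall k, k \in msupp (<< m >> - << m' >> : {malg R[M]}) = (k == m) || (k == m').
Proof.
move=> mm' k; rewrite -mcoeff_neq0 mcoeffB !mcoeffU (eq_sym k m) (eq_sym k m').
have [<-|_] := eqVneq m k; first by rewrite (eq_sym m') (negPf mm') subr0 oner_eq0.
by have [_|_] := eqVneq m' k; rewrite ?subrr ?eqxx // sub0r oppr_eq0 oner_eq0.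
Qed.

Section Monomials.
Context (K : fieldType) (I : choiceType).
Implicit Types (m n s : {cmonom I}) (S : {cmonom I} -> Prop).

Lemma mem_monomial_ideal S m : monomial_ideal (K := K) S << m >> ->
  exists2 s, S s & exists n, m = mmul n s.
Proof.
move=> [t tS mE].
have [u ut um] : exists2 u, u \in t & (u.1 * u.2)@_m != 0.
  apply/hasP; apply: contraT => /hasPn h; have := mcoeffUU m (1 : K).
  rewrite mE raddf_sum big_seq big1 => [/esym/eqP|u /h /negPn/eqP//].
  by rewrite oner_eq0.
have [s Ss uE] := tS _ ut; exists s => //.
rewrite uE mcoeff_neq0 in um; have [k1 [k2 [_ k2s ->]]] := msuppM_le um.
by move: k2s; rewrite msuppU1 => /fset1P ->; exists k1.
Qed.

Lemma cmonom_mulI n : injective (mmul n).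
Proof.
move=> m m' /eqP/cmP nm; apply/eqP/cmP => x.
by have := nm x; rewrite !cmM => /addnI.
Qed.

Lemma cmonom_dvd s m : (forall x, s x <= m x)%N -> exists n, m = mmul n s.
Proof.
move=> sm; exists (divcm m s); apply/eqP/cmP => x.
by rewrite cmM divcmE subnK.
Qed.
End Monomials.

Section MonomialOrder.
Context (I : choiceType) (le : rel {cmonom I}) (le_mo : monomial_order le).
Implicit Types m n : {cmonom I}.

Lemma monomial_order_refl : reflexive le.
Proof. by case: le_mo => tot _ _ _ _ m; case/orP: (tot m m). Qed.

Lemma monomial_order_mul m m' n n' :
  le m m' -> le n n' -> le (mmul m n) (mmul m' n').
Proof.
case: le_mo => _ _ tr _ mul mm' nn'; apply: tr (mul _ _ n mm') _.
by rewrite !(mulmC m'); apply: mul.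
Qed.

Lemma min_monomial (J : finType) (P : pred J) (F : J -> {cmonom I}) i0 : P i0 ->
  exists2 j, P j & forall k, P k -> le (F j) (F k).
Proof.
case: le_mo => tot _ tr _ _ Pi0.
by have [j Pj jmin] := extremumP F monomial_order_refl tr tot Pi0; exists j.
Qed.

Lemma monomial_order_cancel n m m' :
  le (mmul n m) (mmul n m') -> le m m'.
Proof.
case: le_mo => tot asym _ _ mul nm.
have [//|m'm] := orP (tot m m').
suff /cmonom_mulI -> : mmul n m = mmul n m' by case/orP: (tot m' m').
by apply: asym; rewrite nm !(mulmC n) mul.
Qed.
End MonomialOrder.

(** * Standard monomials of the join-meet ideal *)

Section JoinMeet.
Context (d : Order.disp_t) (L : finLatticeType d) (K : fieldType).
Implicit Types (m n s : {cmonom L}) (a b x y z : L) (T : pred {cmonom L}).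

(** Equivalently, T is a union of classes of congruent monomials. *)
Definition move_invariant T := forall n a b, (a >< b)%O ->
  T (mmul n (mmul (ucm a) (ucm b)))
    = T (mmul n (mmul (ucm (a `&` b)%O) (ucm (a `|` b)%O))).

Lemma varM a b : var K a * var K b = << mmul (ucm a) (ucm b) >>.
Proof. exact: malgUM. Qed.

Lemma join_meet_binomialE a b :
  var K a * var K b - var K (a `&` b)%O * var K (a `|` b)%O =
  << mmul (ucm a) (ucm b) >> - << mmul (ucm (a `&` b)%O) (ucm (a `|` b)%O) >>.
Proof. by congr (_ - _); apply: varM. Qed.

Definition coeff_sum T (f : {malg K[{cmonom L}]}) : K :=
  mmap idfun (fun m => (T m)%:R : K) f.

Lemma coeff_sum_ideal T f :
  move_invariant T -> @join_meet_ideal K d L f -> coeff_sum T f = 0.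
Proof.
move=> Tinv [s sgen ->]; rewrite /coeff_sum raddf_sum big_seq.
rewrite big1// => -[p q] us.
have [a [b [ab /= ->]]] := sgen _ us; rewrite join_meet_binomialE.
by apply: mmap_binomialM => n; rewrite Tinv.
Qed.

Definition congruent m m' :=
  @join_meet_ideal K d L (<< m >> - << m' >> : {malg K[{cmonom L}]}).

Lemma congruent_sym m m' : congruent m m' -> congruent m' m.
Proof.
by move=> /(ideal_genM (-1)); rewrite mulN1r opprB.
Qed.

Lemma congruent_trans m1 m2 m3 :
  congruent m1 m2 -> congruent m2 m3 -> congruent m1 m3.
Proof. by move=> /ideal_genD h /h; rewrite addrA subrK. Qed.

Lemma congruent_refl m : congruent m m.
Proof. by rewrite /congruent subrr; apply: ideal_gen0. Qed.

Lemma congruentM m1 m1' m2 m2' : congruent m1 m1' -> congruent m2 m2' ->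
  congruent (mmul m1 m2) (mmul m1' m2').
Proof.
move=> h1 h2; rewrite /congruent (binomialM K m1 m1' m2 m2').
exact: ideal_genD (ideal_genM << m1 >> h2) (ideal_genM << m2' >> h1).
Qed.

Lemma congruent_move a b : (a >< b)%O ->
  congruent (mmul (ucm a) (ucm b)) (mmul (ucm (a `&` b)%O) (ucm (a `|` b)%O)).
Proof.
move=> ab; apply: ideal_gen_mem; exists a, b; split=> //.
exact/esym/join_meet_binomialE.
Qed.

Section SquarefreeInitial.
Context (le : rel {cmonom L}) (le_mo : monomial_order le).

(** A standard monomial is the smallest one of its class; any union of classes
of which it is the smallest element certifies this. *)
Definition standard m := exists T,
  [/\ move_invariant T, T m & forall m', T m' -> le m m'].

(** If m = n s, then s is the smallest element of the class-closed set of all m'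
with n m' in T, so the linear form of that set isolates the coefficient of s
in g. *)
Lemma standard_not_initial m n s g : standard m -> m = mmul n s ->
  @join_meet_ideal K d L g -> ~ is_initial_monomial le g s.
Proof.
move=> [T [Tinv Tm Tmin]] mE Ig [sg slead].
pose T' : pred {cmonom L} := fun m' => T (mmul n m').
have T'inv : move_invariant T'.
  by move=> n' a b ab; rewrite /T' !mulmA -!(mulmA (mmul n n')); apply: Tinv.
have := coeff_sum_ideal T'inv Ig; rewrite /coeff_sum /mmap.
rewrite (big_fsetD1 s) //= big1_fset => [|m' m'g _].
  by rewrite /T' -mE Tm mulr1 addr0 => /eqP; rewrite mcoeff_eq0 sg.
move: m'g; rewrite in_fsetD1 /T' => /andP[m's m'g].
case Tm': (T _); last by rewrite mulr0.
case/eqP: m's; case: (le_mo) => _ asym _ _ _; apply: asym.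
by rewrite slead // (@monomial_order_cancel _ le le_mo n) // -mE Tmin.
Qed.

Hypothesis sqf : squarefree_ideal (initial_ideal le (@join_meet_ideal K d L)).

(** m is divisible by a squarefree generator s of the initial ideal, and s by an
initial monomial s'; being squarefree and supported on the variables of m0, s'
divides m0. *)
Lemma initial_support m m0 f : standard m0 ->
    @join_meet_ideal K d L f -> is_initial_monomial le f m ->
  ~ (forall x, m0 x = 0%N -> m x = 0%N).
Proof.
move=> m0std If fm m_m0.
have [S Ssqf SE] := sqf.
have f0 : f != 0.
  by apply: contraTneq fm.1 => ->; rewrite msupp0 in_fset0.
have /SE/mem_monomial_ideal[s Ss [n mE]] :
    initial_ideal le (@join_meet_ideal K d L) << m >>.
  by apply: ideal_gen_mem; exists m => //; exists f.
have /SE/mem_monomial_ideal[s' [g [Ig g0 gs']] [n' sE]] :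
    monomial_ideal (K := K) S << s >>.
  by apply: ideal_gen_mem; exists s.
have [n0 m0E] : exists n0, m0 = mmul n0 s'.
  apply: cmonom_dvd => x; have := Ssqf s Ss x; rewrite sE cmM => s'1.
  have [x0|x0] := posnP (m0 x).
    by have := m_m0 x x0; rewrite mE sE !cmM x0; lia.
  by lia.
exact: (standard_not_initial m0std m0E Ig gs').
Qed.

(** The variables of a standard monomial are algebraically independent modulo
the ideal: of two distinct congruent monomials the larger one is initial. *)
Lemma standard_independent m0 m m' : standard m0 -> congruent m m' ->
    (forall x, m0 x = 0%N -> m x = 0%N /\ m' x = 0%N) ->
  m = m'.
Proof.
move=> m0std mm' supp; apply/eqP/negPn/negP => neq.
have [tot _ _ _ _] := le_mo.
have suppE := msupp_binomial K neq.
have [m'm|mlem'] := orP (tot m' m).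
  apply: (initial_support m0std mm' (m := m)) => [|x /supp[]//]; split.
    by rewrite suppE eqxx.
  by move=> k; rewrite suppE => /orP[]/eqP-> //; case/orP: (tot m m).
apply: (initial_support m0std mm' (m := m')) => [|x /supp[]//]; split.
  by rewrite suppE eqxx orbT.
by move=> k; rewrite suppE => /orP[]/eqP-> //; case/orP: (tot m' m').
Qed.
End SquarefreeInitial.
End JoinMeet.

(** * Monomials on a line *)

Section MonomialSupport.
Context (L : finType).
Implicit Types (m n : {cmonom L}) (P : pred L) (w : L -> nat).

Definition supp_all P m := [forall x, (m x != 0%N) ==> P x].

Lemma supp_allM P m n : supp_all P (mmul m n) = supp_all P m && supp_all P n.
Proof.
apply/forallP/andP => [Pmn|[/forallP Pm /forallP Pn] x].
  split; apply/forallP => x; apply/implyP => mx; have /implyP := Pmn x;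
    by apply; rewrite cmM; lia.
rewrite cmM addn_eq0 negb_and; apply/implyP => /orP[mx|nx].
  exact: (implyP (Pm x)).
exact: (implyP (Pn x)).
Qed.

Lemma supp_allU P x : supp_all P (ucm x) = P x.
Proof.
apply/forallP/idP => [/(_ x)|Px y]; first by rewrite cmUU.
by rewrite cmU; apply/implyP; case: (eqVneq x y) => [<-|].
Qed.

Definition weight w m := (\sum_(x : L) m x * w x)%N.

Lemma weightM w m n : weight w (mmul m n) = (weight w m + weight w n)%N.
Proof.
by rewrite /weight -big_split; apply: eq_bigr => x _; rewrite cmM mulnDl.
Qed.

Lemma weightU w x : weight w (ucm x) = w x.
Proof.
rewrite /weight (bigD1 x) //= cmUU mul1n big1 ?addn0 // => y yx.
by rewrite cmU eq_sym (negPf yx).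
Qed.

Lemma mdegS_factor m k : mdeg m = k.+1 ->
  exists x n, m = mmul (ucm x) n /\ mdeg n = k.
Proof.
move=> degm.
have [x mx] : exists x, m x != 0%N.
  apply/existsP; apply: contraT => /existsPn m0.
  suff m1 : m = mone by rewrite m1 mdeg1 in degm.
  by apply/eqP/cmP => x; rewrite cm1; apply/eqP/negPn/m0.
have [n mE] : exists n, m = mmul n (ucm x).
  by apply: cmonom_dvd => y; rewrite cmU; case: eqVneq => [<-|//]; lia.
exists x, n; split; first by rewrite mulmC.
by move: degm; rewrite mE mdegM mdegU addn1 => -[].
Qed.
End MonomialSupport.

Section Line.
Context (d : Order.disp_t) (L : finLatticeType d) (o i : L).
Hypotheses (oi : (o < i)%O) (oi_line : line o i).
Implicit Types (x y z t : L) (m n : {cmonom L}).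

Definition height x : nat := if x == o then 0 else if x == i then 2 else 1.

(** The monomials of degree k whose variables have meet o, lie below i and have
heights adding up to k.  Meet, upper bound, degree and total height are all
preserved by moves.  For k = 2 this is the class of oi and, if there are three
middle elements, for k = 3 it is the class of x oi for any middle element x; the
condition on the meet excludes the powers x^k. *)
Definition line_monomial k : pred {cmonom L} := fun m =>
  [&& supp_all (fun x => x <= i)%O m,
      [forall z, supp_all (fun x => z <= x)%O m == (z <= o)%O],
      mdeg m == k & weight height m == k].

Lemma heightP x : (o <= x <= i)%O ->
  [\/ x = o /\ height x = 0%N, x = i /\ height x = 2
    | (o < x < i)%O /\ height x = 1%N].
Proof.
rewrite /height !le_eqVlt => /andP[/predU1P[<-|ox]].
  by constructor 1; rewrite eqxx.
move=> /predU1P[->|xi].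
  by constructor 2; rewrite eqxx (gt_eqF oi).
constructor 3; rewrite ox xi; split=> //.
by rewrite (gt_eqF ox) (lt_eqF xi).
Qed.

Lemma lower_move z x y :
  ((z <= x) && (z <= y) = (z <= x `&` y) && (z <= x `|` y))%O.
Proof.
rewrite -lexI; case: (boolP (z <= _)%O) => //= h.
by rewrite lexUl // (le_trans h) ?leIl.
Qed.

Lemma upper_move z x y :
  ((x <= z) && (y <= z) = (x `&` y <= z) && (x `|` y <= z))%O.
Proof.
rewrite -leUx andbC; case: (boolP (_ <= z)%O) => //= h.
by rewrite leIxl // (le_trans _ h) ?leUl.
Qed.

Lemma height_move x y : (o <= x <= i)%O -> (o <= y <= i)%O -> (x >< y)%O ->
  (height x + height y = height (x `&` y)%O + height (x `|` y)%O)%N.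
Proof.
move=> xI yI xy.
have [ox xi] := andP xI; have [oy yi] := andP yI.
have [[xE _]|[xE _]|[xm ->]] := heightP xI.
- by rewrite xE /Order.comparable oy in xy.
- by rewrite xE /Order.comparable yi orbT in xy.
have [[yE _]|[yE _]|[ym ->]] := heightP yI.
- by rewrite yE /Order.comparable ox orbT in xy.
- by rewrite yE /Order.comparable xi in xy.
have x_y : x != y by apply: contraNneq xy => ->; rewrite /Order.comparable lexx.
have [-> ->] := oi_line xm ym x_y.
by rewrite /height !eqxx (gt_eqF oi).
Qed.

Lemma line_monomial_move k : move_invariant (line_monomial k).
Proof.
move=> n a b ab; rewrite /line_monomial !supp_allM !supp_allU -upper_move.
have -> : [forall z, supp_all (fun x => (z <= x)%O)
      (mmul n (mmul (ucm a) (ucm b))) == (z <= o)%O] =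
    [forall z, supp_all (fun x => (z <= x)%O)
      (mmul n (mmul (ucm (a `&` b)%O) (ucm (a `|` b)%O))) == (z <= o)%O].
  by apply: eq_forallb => z; rewrite !supp_allM !supp_allU -lower_move.
apply: andb_id2l => /and3P[_ ai bi]; apply: andb_id2l => /forallP/(_ o).
rewrite lexx !supp_allM !supp_allU -lower_move => /eqP/and3P[_ oa ob].
rewrite !mdegM !mdegU !weightM !weightU height_move ?oa ?ob //.
Qed.

(** The factors, in either order, of the monomials congruent to oi. *)
Definition line_pair x y :=
  [&& (o <= x <= i)%O, (o <= y <= i)%O, x != y & (height x + height y == 2)%N].

Lemma line_pairP x y : line_pair x y ->
  [\/ x = o /\ y = i, x = i /\ y = o
    | [/\ (o < x < i)%O, (o < y < i)%O & x != y]].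
Proof.
move=> /and4P[xI yI xy].
have [[xE ->]|[xE ->]|[xm ->]] := heightP xI;
have [[yE ->]|[yE ->]|[ym ->]] // := heightP yI; move=> _.
- by constructor 1.
- by constructor 2.
- by constructor 3.
Qed.

Lemma line_pair_meet x y : line_pair x y -> (x `&` y = o)%O.
Proof.
case/line_pairP => [[-> ->]|[-> ->]|[xm ym xy]].
- exact/meet_idPl/ltW.
- exact/meet_idPr/ltW.
- by case: (oi_line xm ym xy).
Qed.

Lemma line_pair_monomial x y : line_pair x y ->
  line_monomial 2 (mmul (ucm x) (ucm y)).
Proof.
move=> xy; have /and4P[/andP[ox xi] /andP[oy yi] _ /eqP hxy] := xy.
rewrite /line_monomial supp_allM !supp_allU xi yi mdegM !mdegU.
rewrite weightM !weightU hxy !andbT; apply/forallP => z.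
by rewrite supp_allM !supp_allU -lexI line_pair_meet.
Qed.

Lemma line_monomial3 x : (o < x < i)%O ->
  line_monomial 3 (mmul (ucm x) (mmul (ucm o) (ucm i))).
Proof.
move=> /andP[ox xi]; rewrite /line_monomial !supp_allM !supp_allU !mdegM !mdegU.
rewrite !weightM !weightU /height !eqxx (gt_eqF ox) (lt_eqF xi) (gt_eqF oi).
rewrite lexx !ltW //= andbT; apply/forallP => z; rewrite !supp_allM !supp_allU.
case: (boolP (z <= o)%O) => zo; last by rewrite andbF.
by rewrite !(le_trans zo) // ltW.
Qed.

Lemma line_monomial2P m : line_monomial 2 m ->
  exists x y, line_pair x y /\ m = mmul (ucm x) (ucm y).
Proof.
move=> /and4P[mi /forallP lbm /eqP degm /eqP wm].
have [x [m1 [mE m1deg]]] := mdegS_factor degm.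
have [y [m2 [m1E /mdeg_eq0I m2E]]] := mdegS_factor m1deg.
rewrite m2E mulm1 in m1E; rewrite m1E in mE.
exists x, y; split=> //.
move: (lbm o) mi wm; rewrite lexx mE !supp_allM !supp_allU weightM !weightU.
move=> /eqP/andP[ox oy] /andP[xi yi] wxy.
rewrite /line_pair ox oy xi yi wxy eqxx /= andbT.
apply/eqP => xy; have := lbm x.
rewrite mE supp_allM !supp_allU -xy lexx => /eqP/esym xo.
have x0 : x = o by apply/le_anti; rewrite xo ox.
by rewrite -xy x0 /height eqxx in wxy.
Qed.

(** The total height 3 is odd, so one of the three variables is a middle element
x and the other two have heights adding up to 2.  If those two coincide, they
are equal to a middle element y different from x, and m = y (x y). *)
Lemma line_monomial3P m : line_monomial 3 m -> exists x y z,
  [/\ (o < x < i)%O, line_pair y z & m = mmul (ucm x) (mmul (ucm y) (ucm z))].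
Proof.
move=> /and4P[mi /forallP lbm /eqP degm /eqP wm].
have [x [y [z [mE xm]]]] : exists x y z,
    m = mmul (ucm x) (mmul (ucm y) (ucm z)) /\ (o < x < i)%O.
{ have [x [m1 [mE m1deg]]] := mdegS_factor degm.
  have [y [m2 [m1E m2deg]]] := mdegS_factor m1deg.
  have [z [m3 [m2E /mdeg_eq0I m3E]]] := mdegS_factor m2deg.
  rewrite m3E mulm1 in m2E; rewrite m2E in m1E; rewrite m1E in mE.
  move: (lbm o) mi wm; rewrite lexx mE !supp_allM !supp_allU !weightM !weightU.
  move=> /eqP/and3P[ox oy oz] /and3P[xi yi zi] wxyz.
  have [[_ hx]|[_ hx]|[xm _]] := @heightP x (introT andP (conj ox xi));
    last by exists x, y, z.
  all: have [[_ hy]|[_ hy]|[ym _]] := @heightP y (introT andP (conj oy yi));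
    last by exists y, x, z; rewrite mmulCA.
  all: have [[_ hz]|[_ hz]|[zm _]] := @heightP z (introT andP (conj oz zi));
    last by exists z, x, y; split=> //; rewrite (mulmC (ucm y)) mmulCA.
  all: by move: wxyz; rewrite hx hy hz. }
move: (lbm o) mi wm; rewrite lexx mE !supp_allM !supp_allU !weightM !weightU.
move=> /eqP/and3P[ox oy oz] /and3P[xi yi zi].
have [[xE _]|[xE _]|[_ ->]] := @heightP x (introT andP (conj ox xi)).
- by rewrite xE ltxx in xm.
- by rewrite xE ltxx andbF in xm.
move=> wxyz; have wyz : (height y + height z = 2)%N by lia.
have [yz|yz] := eqVneq y z; last first.
  by exists x, y, z; split=> //; rewrite /line_pair oy oz yi zi yz wyz.
have wy : height y = 1%N by move: wyz; rewrite -yz; lia.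
have yI := @heightP y (introT andP (conj oy yi)).
have ym : (o < y < i)%O by case: yI => [[_]|[_]|[//]]; rewrite wy.
have xy : x != y.
  apply/eqP => xy; have := lbm x.
  rewrite mE !supp_allM !supp_allU -yz -xy lexx => /eqP/esym xo.
  by case/andP: xm => ox'; rewrite (lt_geF ox') in xo.
have hx : height x = 1%N.
  have [[xE _]|[xE _]|[_ //]] := @heightP x (introT andP (conj ox xi)).
    by rewrite xE ltxx in xm.
  by rewrite xE ltxx andbF in xm.
exists y, x, y; split=> //; last by rewrite -yz mmulCA.
by rewrite /line_pair ox oy xi yi xy hx wy.
Qed.

Context (K : fieldType).
Let cong := @congruent d L K.

Lemma congruent_line x y : (o < x < i)%O -> (o < y < i)%O -> x != y ->
  cong (mmul (ucm x) (ucm y)) (mmul (ucm o) (ucm i)).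
Proof.
move=> xm ym xy; have [xyo xyi] := oi_line xm ym xy.
have x_y : (x >< y)%O.
  apply/negP => /orP[/meet_idPl|/meet_idPr]; rewrite xyo => E.
    by rewrite -E ltxx in xm.
  by rewrite -E ltxx in ym.
by have := congruent_move K x_y; rewrite xyo xyi.
Qed.

(** x (xy) ~ x (yz) = y (zx) ~ y (xy). *)
Lemma congruent_line_swap x y z :
    (o < x < i)%O -> (o < y < i)%O -> (o < z < i)%O ->
    [/\ x != y, y != z & z != x] ->
  cong (mmul (ucm x) (mmul (ucm x) (ucm y)))
       (mmul (ucm y) (mmul (ucm x) (ucm y))).
Proof.
move=> xm ym zm [xy yz zx].
have xy_yz := congruent_trans (congruent_line xm ym xy)
                              (congruent_sym (congruent_line ym zm yz)).
have zx_xy := congruent_trans (congruent_line zm xm zx)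
                              (congruent_sym (congruent_line xm ym xy)).
apply: (congruent_trans (congruentM (congruent_refl _ (ucm x)) xy_yz)).
rewrite mmulCA (mulmC (ucm x) (ucm z)).
exact: (congruentM (congruent_refl _ (ucm y)) zx_xy).
Qed.

(** (xx)(oi) ~ (xx)(yz) = (xy)(zx) ~ (oi)(oi). *)
Lemma congruent_line_square x y z :
    (o < x < i)%O -> (o < y < i)%O -> (o < z < i)%O ->
    [/\ x != y, y != z & z != x] ->
  cong (mmul (mmul (ucm x) (ucm x)) (mmul (ucm o) (ucm i)))
       (mmul (mmul (ucm o) (ucm i)) (mmul (ucm o) (ucm i))).
Proof.
move=> xm ym zm [xy yz zx].
have xyxz := congruentM (congruent_line xm ym xy) (congruent_line zm xm zx).
apply: congruent_trans xyxz.
have := congruentM (congruent_refl _ (mmul (ucm x) (ucm x)))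
  (congruent_sym (congruent_line ym zm yz)).
congr (cong _ _).
by rewrite (mulmC (ucm z)) mmulACA.
Qed.

Context (le : rel {cmonom L}) (le_mo : monomial_order le).

(** In both cases below a standard monomial supports two distinct congruent
monomials: xoi when oi is the smallest monomial of its class, and the smallest
monomial yz otherwise. *)
Lemma line_not_squarefree a b c :
    (o < a < i)%O -> (o < b < i)%O -> (o < c < i)%O ->
    [/\ a != b, b != c & c != a] ->
  ~ squarefree_ideal (initial_ideal le (@join_meet_ideal K d L)).
Proof.
move=> am bm cm [ab bc ca] sqf.
have third x y : exists z, [/\ (o < z < i)%O, z != x & z != y].
  have [/andP[]|] := boolP ((a != x) && (a != y)); first by exists a.
  have [/andP[]|] := boolP ((b != x) && (b != y)); first by exists b.
  have [/andP[]|] := boolP ((c != x) && (c != y)); first by exists c.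
  rewrite !negb_and !negbK.
  by move=> /orP[]/eqP cE /orP[]/eqP bE /orP[]/eqP aE;
    move: ab bc ca; rewrite aE bE cE ?eqxx.
have oi_pair : line_pair o i.
  by rewrite /line_pair !lexx !ltW // (lt_eqF oi) /height !eqxx (gt_eqF oi).
have [[y z] /= yz yz_min] :=
  min_monomial le_mo (P := fun p : L * L => line_pair p.1 p.2)
  (fun p => mmul (ucm p.1) (ucm p.2)) (i0 := (o, i)) oi_pair.
have std_yz : standard le (mmul (ucm y) (ucm z)).
  exists (line_monomial 2); split;
    [exact: line_monomial_move | exact: line_pair_monomial |].
  by move=> m /line_monomial2P[x [t [xt ->]]]; apply: (yz_min (x, t)).
have [oi_min|[ym zm y_z]] : le (mmul (ucm o) (ucm i)) (mmul (ucm y) (ucm z))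
    \/ [/\ (o < y < i)%O, (o < z < i)%O & y != z].
  case/line_pairP: (yz) => [[-> ->]|[-> ->]|]; [left | left | by right].
    exact: (monomial_order_refl le_mo).
  by rewrite mulmC; apply: (monomial_order_refl le_mo).
- have [x xm x_min] := min_monomial le_mo (P := fun x => (o < x < i)%O)
    (fun x => ucm x) am.
  have std_xoi : standard le (mmul (ucm x) (mmul (ucm o) (ucm i))).
    exists (line_monomial 3); split;
      [exact: line_monomial_move | exact: line_monomial3 |].
    move=> m /line_monomial3P[t [u [v [tm uv ->]]]].
    apply: (monomial_order_mul le_mo); first exact: x_min.
    by case: le_mo => _ _ tr _ _; apply: tr oi_min (yz_min (u, v) uv).
  have [u [um ux _]] := third x x; have [v [vm vx vu]] := third x u.
  have xu : x != u by rewrite eq_sym.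
  have uv : u != v by rewrite eq_sym.
  have sq := congruent_line_square xm um vm (And3 xu uv vx).
  have := standard_independent le_mo sqf std_xoi sq.
  have supp t : mmul (ucm x) (mmul (ucm o) (ucm i)) t = 0%N ->
      mmul (mmul (ucm x) (ucm x)) (mmul (ucm o) (ucm i)) t = 0%N /\
      mmul (mmul (ucm o) (ucm i)) (mmul (ucm o) (ucm i)) t = 0%N.
    rewrite !cmM => /eqP; rewrite !addn_eq0.
    by move=> /and3P[/eqP-> /eqP-> /eqP->].
  move=> /(_ supp); rewrite mulmC => /cmonom_mulI/eqP/cmP/(_ o).
  rewrite !cmM !cmU eqxx (gt_eqF oi).
  by case/andP: xm => /gt_eqF ->.
have [x [xm xy xz]] := third y z.
have zx : z != x by rewrite eq_sym.
have sw := congruent_line_swap ym zm xm (And3 y_z zx xy).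
have supp t : mmul (ucm y) (ucm z) t = 0%N ->
    mmul (ucm y) (mmul (ucm y) (ucm z)) t = 0%N /\
    mmul (ucm z) (mmul (ucm y) (ucm z)) t = 0%N.
  by rewrite !cmM => /eqP; rewrite addn_eq0 => /andP[/eqP-> /eqP->].
have := standard_independent le_mo sqf std_yz sw supp.
rewrite ![mmul _ (mmul _ _)]mulmC => /cmonom_mulI/eqP/cmP/(_ y).
by rewrite !cmU eqxx eq_sym (negPf y_z).
Qed.
End Line.

Theorem theorem1p3 (d : Order.disp_t) (L : finLatticeType d)
    (Lmod : modular_lattice L) (Lndistr : ~ distributive_lattice L)
    (K : fieldType)
    (le : rel {cmonom L}) (le_mo : monomial_order le) :
  ~ squarefree_ideal (initial_ideal le (@join_meet_ideal K d L)).
Proof.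
have [o [i [oi_line [a [b [c [am bm cm abc]]]]]]] :=
  modular_nondistributive_line Lmod Lndistr.
have /andP[oa ai] := am.
exact: (@line_not_squarefree _ _ _ _ (lt_trans oa ai) oi_line K _ le_mo
          _ _ _ am bm cm abc).
Qed.
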